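(* Let $G$ be an infinite commutative group, let $f:G\to\mathbb{R}$ be a bounded function, and let $\alpha\in[M_*(f),M^*(f)]$ be any number. Then there is a full mean $M$ on $G$ such that $M(f)=\alpha$.
   Context: $G$ is an infinite commutative (discrete) group, written additively. For a bounded function $f:G\to\mathbb{R}$, the uppermost and lowest means are $$M^*(f)=\inf_g\sup_{x\in G} g(x),\qquad M_*(f)=\sup_g\inf_{x\in G} g(x),$$ where $g$ runs over all convex combinations of translates of $f$, i.e. all functions $g(x)=\sum_{i=1}^n c_i f(x+t_i)$ with $n\ge1$, $t_i\in G$, $c_i\ge0$, $\sum c_i=1$. An upper mean is a functional $\overline M$ assigning a real number to every bounded function $f:G\to\mathbb{R}$ such that: (norming) $\overline M(f)=c$ if $f\equiv c$; (monotonicity) $f\le g$ implies $\overline M(f)\le\overline M(g)$; (homogeneity) $\overline M(cf)=c\overline M(f)$ for every constant $c\ge0$; (restricted additivity) if $t\in G$ and $g(x)=f(x)+f(x+t)$, then $\overline M(g)=2\overline M(f)$; (subadditivity) $\overline M(f+g)\le\overline M(f)+\overline M(g)$. The conjugate lower mean of an upper mean $\overline M$ is $\underline M(f)=-\overline M(-f)$. A functional $M$ defined on a subspace $L$ of the bounded functions is called a mean if there is an upper mean $\overline M$ with conjugate lower mean $\underline M$ such that $\underline M(f)=\overline M(f)$ holds exactly for $f\in L$, and for $f\in L$ this common value is $M(f)$. A mean is full if $L$ consists of all bounded real functions on $G$. *)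

(* Defs.v *)
From HB Require Import structures.
From mathcomp Require Import all_boot all_order all_algebra.
From mathcomp Require Import all_classical all_reals all_analysis.

Set Implicit Arguments.
Unset Strict Implicit.
Unset Printing Implicit Defensive.

Import Order.TTheory GRing.Theory Num.Theory.
Import numFieldNormedType.Exports.
Local Open Scope classical_set_scope.
Local Open Scope ring_scope.

Definition translate_average (R : realType) (G : zmodType) (f : G -> R) :
    set (G -> R) :=
  [set g | exists (n : nat) (c : 'I_n -> R) (t : 'I_n -> G),
     [/\ (0 < n)%N, forall i, 0 <= c i, \sum_(i < n) c i = 1 &
         g = fun x => \sum_(i < n) c i * f (x + t i)]].

(* [sup] and [inf] are the real-valued ones of the library; they are the true
   supremum and infimum when f is bounded. *)
Definition uppermost_mean (R : realType) (G : zmodType) (f : G -> R) : R :=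
  inf [set sup (range g) | g in translate_average f].

Definition lowest_mean (R : realType) (G : zmodType) (f : G -> R) : R :=
  sup [set inf (range g) | g in translate_average f].

(* A functional on the bounded functions is encoded as a functional on all
   functions G -> R, whose values at unbounded functions are irrelevant. *)
Record is_upper_mean (R : realType) (G : zmodType) (U : (G -> R) -> R) : Prop :=
  IsUpperMean {
    upper_mean_norming : forall c : R, U (fun=> c) = c;
    upper_mean_monotone : forall f g : G -> R, bounded_fun f -> bounded_fun g ->
      (forall x, f x <= g x) -> U f <= U g;
    upper_mean_homogeneous : forall (c : R) (f : G -> R), bounded_fun f ->
      0 <= c -> U (fun x => c * f x) = c * U f;
    upper_mean_restricted_additive : forall (t : G) (f : G -> R),
      bounded_fun f -> U (fun x => f x + f (x + t)) = 2 * U f;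
    upper_mean_subadditive : forall f g : G -> R, bounded_fun f ->
      bounded_fun g -> U (fun x => f x + g x) <= U f + U g
  }.

Definition conjugate_lower_mean (R : realType) (G : zmodType)
    (U : (G -> R) -> R) (f : G -> R) : R := - U (fun x => - f x).

Definition is_subspace (R : realType) (G : zmodType) (L : set (G -> R)) : Prop :=
  L (fun=> 0) /\
  forall (a : R) (f g : G -> R), L f -> L g -> L (fun x => a * f x + g x).

(* M is a mean with domain L; its values outside L are irrelevant. *)
Definition is_mean (R : realType) (G : zmodType) (L : set (G -> R))
    (M : (G -> R) -> R) : Prop :=
  [/\ L `<=` bounded_fun, is_subspace L &
      exists U : (G -> R) -> R,
        [/\ is_upper_mean U,
            forall f : G -> R, bounded_fun f ->
              (conjugate_lower_mean U f = U f <-> L f) &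
            forall f : G -> R, L f -> M f = U f]].

Definition is_full_mean (R : realType) (G : zmodType) (M : (G -> R) -> R) :
    Prop :=
  is_mean bounded_fun M.

(* Main.v *)
(** Hahn-Banach with the uppermost mean [p] as dominating functional.
    Averages of averages commute because [G] is commutative, so [p] is
    sublinear on the bounded functions.  The condition
    [M_*(f) <= alpha <= M^*(f)] says [alpha <= p f] and [- alpha <= p (- f)],
    which is exactly what is needed for a linear [U <= p] with
    [U f = alpha] to exist.  Any such [U] is normed and monotone, and it is
    translation invariant since [f (x + t) - f x] has averages of the form
    [(f (x + n t) - f x) / n], whence [p (f (. + t) - f) <= 0]. *)
Require Import Defs.
From mathcomp Require Import all_boot all_order all_algebra.
From mathcomp Require Import all_classical all_reals all_analysis.
From mathcomp Require Import lra.
Import Order.TTheory GRing.Theory Num.Theory.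
Import numFieldNormedType.Exports.
Local Open Scope classical_set_scope.
Local Open Scope ring_scope.

(** * Bounds on infima of sets of reals *)

Lemma le_inf_add (R : realType) (X Y : set R) (a : R) :
  X !=set0 -> Y !=set0 -> (forall x y, X x -> Y y -> a <= x + y) ->
  a <= inf X + inf Y.
Proof.
move=> X0 Y0 aXY; rewrite addrC -lerBlDr; apply: lb_le_inf => // y Yy.
rewrite lerBlDr addrC -lerBlDr; apply: lb_le_inf => // x Xx.
by rewrite lerBlDr; exact: aXY.
Qed.

Lemma le_mul_inf (R : realType) (X : set R) (a c : R) :
  0 < c -> X !=set0 -> (forall x, X x -> a <= c * x) -> a <= c * inf X.
Proof.
move=> c0 X0 aX; rewrite mulrC -ler_pdivrMr//; apply: lb_le_inf => // x Xx.
by rewrite ler_pdivrMr// mulrC; exact: aX.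
Qed.

Lemma inf_lbound (R : realType) (X : set R) (b x : R) :
  (forall y, X y -> b <= y) -> X x -> inf X <= x.
Proof. by move=> bX Xx; apply: ge_inf => //; exists b => y /bX. Qed.

(** * Sublinear functionals and Hahn-Banach *)

Section HahnBanach.
Context {R : realType} {V : lmodType R}.
Implicit Types (D : set V) (p q : V -> R) (v w : V).

(** A predicate rather than a subspace type, so that functionals stay total on [V], as upper means
    are on [G -> R]. *)
Record linear_subset D : Prop := LinearSubset {
  linear_subset0 : D 0;
  linear_subsetD : forall v w, D v -> D w -> D (v + w);
  linear_subsetZ : forall (c : R) v, D v -> D (c *: v) }.

(** The one-sided homogeneity is the form that passes directly to infima; [sublinear_onZ] recovers
    equality. *)
Record sublinear_on D p : Prop := SublinearOn {
  sublinear_onD : forall v w, D v -> D w -> p (v + w) <= p v + p w;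
  sublinear_on_leZ : forall (c : R) v, D v -> 0 < c -> p (c *: v) <= c * p v }.

Context {D : set V} (linD : linear_subset D).

Lemma linear_subsetN v : D v -> D (- v).
Proof. by rewrite -scaleN1r; exact: linear_subsetZ. Qed.

Section Sublinear.
Context {p : V -> R} (subp : sublinear_on D p).

Lemma sublinear_on0 : p 0 = 0.
Proof.
have D0 := linear_subset0 _ linD.
have := sublinear_onD _ _ subp _ _ D0 D0.
(* Halving gives [p 0 <= p 0 / 2], hence [p 0 <= 0]; subadditivity at [0 + 0] gives [0 <= p 0]. *)
have := sublinear_on_leZ _ _ subp 2^-1 _ D0 ltac:(by rewrite invr_gt0).
rewrite scaler0 addr0 => h1 h2; apply/eqP; rewrite eq_le; apply/andP; split; lra.
Qed.

Lemma sublinear_onZ (c : R) v : D v -> 0 <= c -> p (c *: v) = c * p v.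
Proof.
move=> Dv; rewrite le_eqVlt => /predU1P[<-|c0].
  by rewrite scale0r mul0r sublinear_on0.
apply/eqP; rewrite eq_le (sublinear_on_leZ _ _ subp)//=.
(* The reverse inequality is the same axiom for [c^-1] at [c *: v]. *)
have ci0 : 0 < c^-1 by rewrite invr_gt0.
have := sublinear_on_leZ _ _ subp _ _ (linear_subsetZ _ linD c v Dv) ci0.
rewrite scalerA mulVf ?gt_eqF// scale1r => pv.
by rewrite -ler_pdivlMl.
Qed.

Lemma sublinear_on_geN v : D v -> - p (- v) <= p v.
Proof.
move=> Dv; have := sublinear_onD _ _ subp _ _ Dv (linear_subsetN _ Dv).
rewrite subrr sublinear_on0; lra.
Qed.

Section Tilt.
Context {v0 : V} {a : R}.
Hypotheses (Dv0 : D v0) (ap : a <= p v0) (apN : - a <= p (- v0)).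

(** The tilted functional is [inf (line v)]: the infimal convolution of [p] with the linear
    functional [s *: v0 |-> s * a] on the line through [v0]. *)
Let line v := [set p (v + s *: v0) - s * a | s in [set: R]].

Let line_neq0 v : line v !=set0.
Proof. by exists (p (v + 0 *: v0) - 0 * a), 0. Qed.

(** The hypotheses on [a] are the cases [s = 1] and [s = -1]; homogeneity gives the others. *)
Let le_line (s : R) : s * a <= p (s *: v0).
Proof.
have [s0|/ltW s0] := leP 0 s; first by rewrite sublinear_onZ// ler_wpM2l.
rewrite -[s in s *: _]opprK scaleNr -scalerN sublinear_onZ ?oppr_ge0//.
  by rewrite -[s * a]mulrNN ler_wpM2l ?oppr_ge0.
exact: linear_subsetN.
Qed.

(** Makes [inf (line v)] a true infimum: write [s *: v0] as [(v + s *: v0) - v] and use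
    subadditivity with [le_line]. *)
Let line_lb v y : D v -> line v y -> - p (- v) <= y.
Proof.
move=> Dv [s _ <-].
have Ds : D (v + s *: v0).
  by apply: linear_subsetD => //; exact: linear_subsetZ.
have := sublinear_onD _ _ subp _ _ Ds (linear_subsetN _ Dv).
rewrite addrAC subrr add0r; have := le_line s; lra.
Qed.

Lemma sublinear_on_tilt : exists q,
  [/\ sublinear_on D q, forall v, D v -> q v <= p v, q v0 <= a &
      q (- v0) <= - a].
Proof.
have qle v (s : R) : D v -> inf (line v) <= p (v + s *: v0) - s * a.
  move=> Dv; apply: (inf_lbound _ _ (- p (- v))) => [y /line_lb|]; first exact.
  by exists s.
have DZ (s : R) : D (s *: v0) by exact: linear_subsetZ.
exists (fun v => inf (line v)); split; first split.
- move=> v w Dv Dw; apply: le_inf_add => // _ _ [s _ <-] [t _ <-].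
  apply: le_trans (qle _ (s + t) (linear_subsetD _ linD _ _ Dv Dw)) _.
  rewrite scalerDl addrACA mulrDl.
  have := sublinear_onD _ _ subp _ _ (linear_subsetD _ linD _ _ Dv (DZ s))
    (linear_subsetD _ linD _ _ Dw (DZ t)).
  lra.
- move=> c v Dv c0; apply: le_mul_inf => // _ [s _ <-].
  apply: le_trans (qle _ (c * s) (linear_subsetZ _ linD c _ Dv)) _.
  rewrite -scalerA -scalerDr mulrBr mulrA lerD2r.
  by apply: (sublinear_on_leZ _ _ subp) => //; exact: (linear_subsetD _ linD).
- by move=> v Dv; have := qle v 0 Dv; rewrite scale0r addr0 mul0r subr0.
(* The shift [s = -1] carries [v0] to [0], and [s = 1] below does the same for [- v0]. *)
- have := qle _ (-1) Dv0.
  by rewrite scaleN1r subrr sublinear_on0 mulN1r opprK add0r.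
- have := qle _ 1 (linear_subsetN _ Dv0).
  by rewrite scale1r addNr sublinear_on0 mul1r add0r.
Qed.

End Tilt.

End Sublinear.

(** Zorn's lemma: along a chain the pointwise infimum is again sublinear, and it is finite because
    every [q <= p] satisfies [- p (- v) <= q v]. *)
Lemma exists_minimal_sublinear_on {p} (subp : sublinear_on D p) : exists q,
  [/\ sublinear_on D q, forall v, D v -> q v <= p v &
      forall r, sublinear_on D r -> (forall v, D v -> r v <= q v) ->
        forall v, D v -> q v <= r v].
Proof.
pose P q := sublinear_on D q /\ forall v, D v -> q v <= p v.
(* The order is reversed, so that the maximal element from Zorn's lemma is a minimal functional. *)
pose below (q r : {q | P q}) := `[< forall v, D v -> sval r v <= sval q v >].
have Pp : P p by [].
have /(_ _ _ _)[|q r s /asboolP qr /asboolP rs|A chA|q qmin] :=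
    @ZL_preorder _ (exist P p Pp) below.
- by move=> q; apply/asboolP.
- by apply/asboolP => v Dv; exact: le_trans (rs v Dv) (qr v Dv).
(* The empty chain has no meaningful infimum; [p] itself bounds it. *)
- have [->|/set0P[q0 Aq0]] := eqVneq A set0; first by exists (exist P p Pp).
  pose X v := [set sval q v | q in A].
  have X0 v : X v !=set0 by exists (sval q0 v), q0.
  have Xle (q : {q | P q}) v : D v -> A q -> inf (X v) <= sval q v.
    move=> Dv Aq; apply: (@inf_lbound _ _ (- p (- v))); last by exists q.
    move=> _ [[r [subr rp]] _ <-] /=.
    apply: le_trans (sublinear_on_geN subr _ Dv).
    by rewrite lerN2 rp//; exact: linear_subsetN.
  have Pinf : P (fun v => inf (X v)).
    split; first split.
    + move=> v w Dv Dw; have Dvw := linear_subsetD _ linD _ _ Dv Dw.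
      apply: le_inf_add => // _ _ [q Aq <-] [r Ar <-].
      (* The smaller of [q] and [r] serves for both summands: its own subadditivity bounds the
         infimum at [v + w]. *)
      have [/asboolP qr|/asboolP rq] := chA _ _ Aq Ar.
      * apply: le_trans (Xle _ _ Dvw Ar) _.
        apply: le_trans (sublinear_onD _ _ (proj1 (svalP r)) _ _ Dv Dw) _.
        by rewrite lerD2r qr.
      * apply: le_trans (Xle _ _ Dvw Aq) _.
        apply: le_trans (sublinear_onD _ _ (proj1 (svalP q)) _ _ Dv Dw) _.
        by rewrite lerD2l rq.
    + move=> c v Dv c0; apply: le_mul_inf => // _ [q Aq <-].
      apply: le_trans (Xle _ _ (linear_subsetZ _ linD c _ Dv) Aq) _.
      exact: sublinear_on_leZ (proj1 (svalP q)) _ _ Dv c0.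
    + move=> v Dv; apply: le_trans (Xle _ _ Dv Aq0) _.
      exact: (proj2 (svalP q0)).
  exists (exist P _ Pinf) => q Aq; apply/asboolP => v Dv; exact: Xle.
- exists (sval q); have [subq qp] := svalP q; split => // r subr rq.
  have Pr : P r by split=> // v Dv; exact: le_trans (rq v Dv) (qp v Dv).
  have /asboolP := qmin (exist P r Pr) ltac:(exact/asboolP).
  exact.
Qed.

(* A minimal sublinear [q] cannot be tilted towards any [a < q v] with
   [- q (- v) <= a]; the choice [a = - q (- v)] shows that it is odd. *)
Lemma hahn_banach_value {p} (subp : sublinear_on D p) {v0 : V} {a : R} :
  D v0 -> a <= p v0 -> - a <= p (- v0) ->
  exists q, [/\ sublinear_on D q, forall v, D v -> q v <= p v,
    forall v, D v -> q (- v) = - q v & q v0 = a].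
Proof.
move=> Dv0 ap apN.
have [p' [subp' p'p p'v0 p'Nv0]] := sublinear_on_tilt subp Dv0 ap apN.
have [q [subq qp' qmin]] := exists_minimal_sublinear_on subp'.
have qN v : D v -> q (- v) = - q v.
  move=> Dv; have qv := sublinear_on_geN subq _ Dv.
  have [||r [subr rq rv _]] := @sublinear_on_tilt _ subq v (- q (- v)) Dv.
  - exact: qv.
  - by rewrite opprK.
  have := qmin r subr rq v Dv.
  by move=> qr; apply/eqP; rewrite eq_le; apply/andP; split; lra.
exists q; split => //.
- by move=> v Dv; exact: le_trans (qp' v Dv) (p'p v Dv).
(* Tilting left only the upper bounds [a] at [v0] and [- a] at [- v0]; oddness turns the second into
   a lower bound at [v0]. *)
- have := qp' _ Dv0; have := qp' _ (linear_subsetN _ Dv0); rewrite qN// => h1 h2.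
  by apply/eqP; rewrite eq_le; apply/andP; split; lra.
Qed.

End HahnBanach.

(** * The uppermost mean and its sublinearity *)

Section UppermostMean.
Context {R : realType} {G : zmodType}.
Implicit Types (f g h : G -> R).

Lemma bounded_funP f : bounded_fun f <-> exists B, forall x, `|f x| <= B.
Proof.
split=> [[M [_ fM]]|[B fB]].
  by exists (M + 1) => x; apply: fM => //; rewrite ltrDl.
exists B; split; first exact: num_real.
by move=> M /ltW BM x _; exact: le_trans (fB x) BM.
Qed.

Lemma linear_subset_bounded_fun : @linear_subset R (G -> R) bounded_fun.
Proof.
split.
- by apply/bounded_funP; exists 0 => x; rewrite normr0.
- move=> f g /bounded_funP[B fB] /bounded_funP[C gC]; apply/bounded_funP.
  exists (B + C) => x; exact: le_trans (ler_normD _ _) (lerD (fB x) (gC x)).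
- move=> c f /bounded_funP[B fB]; apply/bounded_funP; exists (`|c| * B) => x.
  by rewrite [_ x]/(c * f x) normrM ler_wpM2l.
Qed.

Lemma bounded_fun_translate f t :
  bounded_fun f -> bounded_fun (fun x => f (x + t)).
Proof.
by move=> /bounded_funP[B fB]; apply/bounded_funP; exists B => x; exact: fB.
Qed.

Lemma le_sup_range f x : bounded_fun f -> f x <= sup (range f).
Proof.
move=> /bounded_funP[B fB]; apply: ub_le_sup; last by exists x.
by exists B => _ [y _ <-]; exact: le_trans (ler_norm _) (fB y).
Qed.

Lemma sup_range_le f b : (forall x, f x <= b) -> sup (range f) <= b.
Proof.
move=> fb; apply: ge_sup; first by exists (f 0), 0.
by move=> _ [x _ <-].
Qed.

(** Frees the index type, so that an average of averages can be indexed by pairs. *)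
Lemma translate_average_fin (I : finType) (c : I -> R) (t : I -> G) f :
  (forall i, 0 <= c i) -> \sum_i c i = 1 ->
  translate_average f (fun x => \sum_i c i * f (x + t i)).
Proof.
move=> c0 c1; exists #|I|, (c \o enum_val), (t \o enum_val); split => //.
- rewrite lt0n; apply/eqP => /card0_eq I0.
  move/eqP: c1; rewrite big_pred0 => [|i]; last exact: I0 i.
  by rewrite eq_sym oner_eq0.
- by move=> i; exact: c0.
- by rewrite -c1 (reindex _ (onW_bij _ (@enum_val_bij I))).
- by apply/funext => x; rewrite (reindex _ (onW_bij _ (@enum_val_bij I))).
Qed.

Lemma translate_average_refl f : translate_average f f.
Proof.
exists 1%N, (fun=> 1), (fun=> 0); split => //; first by rewrite big_ord1.
by apply/funext => x; rewrite big_ord1 mul1r addr0.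
Qed.

Lemma translate_average_le f h b :
  translate_average f h -> (forall x, f x <= b) -> forall x, h x <= b.
Proof.
move=> [n [c [t [_ c0 c1 ->]]]] fb x; rewrite -[leRHS]mul1r -c1 mulr_suml.
by apply: ler_sum => i _; rewrite ler_wpM2l.
Qed.

Lemma translate_averageN f h :
  translate_average f h -> translate_average (- f) (- h).
Proof.
move=> [n [c [t [n0 c0 c1 ->]]]]; exists n, c, t; split => //.
apply/funext => x; transitivity (- \sum_(i < n) c i * f (x + t i)) => //.
rewrite -sumrN.
by apply: eq_bigr => i _; rewrite -mulrN.
Qed.

Lemma translate_averageZ (a : R) f h :
  translate_average f h -> translate_average (a *: f) (a *: h).
Proof.
move=> [n [c [t [n0 c0 c1 ->]]]]; exists n, c, t; split => //.
apply/funext => x; transitivity (a * \sum_(i < n) c i * f (x + t i)) => //.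
rewrite mulr_sumr.
by apply: eq_bigr => i _; rewrite mulrCA.
Qed.

Lemma translate_average_bounded f h :
  bounded_fun f -> translate_average f h -> bounded_fun h.
Proof.
move=> /bounded_funP[B fB] fh; apply/bounded_funP; exists B => x.
rewrite ler_norml; apply/andP; split.
  rewrite lerNl; apply: (translate_average_le _ _ _ (translate_averageN _ _ fh)).
  by move=> y; apply: le_trans (fB y); rewrite -normrN ler_norm.
by apply: (translate_average_le _ _ _ fh) => y; exact: le_trans (ler_norm _) (fB y).
Qed.

(** If [B] bounds [|f|], all averages are at least [- B], so the real [inf] is a true infimum. *)
Lemma uppermost_mean_le f h :
  bounded_fun f -> translate_average f h -> uppermost_mean f <= sup (range h).
Proof.
move=> bf fh; have [B fB] := (bounded_funP f).1 bf.
apply: (@inf_lbound _ _ (- B)) => [_ [k fk <-]|]; last by exists h.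
apply: le_trans (le_sup_range _ 0 (translate_average_bounded _ _ bf fk)).
rewrite lerNl; apply: (translate_average_le _ _ _ (translate_averageN _ _ fk)).
by move=> y; apply: le_trans (fB y); rewrite -normrN ler_norm.
Qed.

Lemma uppermost_mean_le_ub f b :
  bounded_fun f -> (forall x, f x <= b) -> uppermost_mean f <= b.
Proof.
move=> bf fb; apply: le_trans (sup_range_le _ _ fb).
exact: uppermost_mean_le bf (translate_average_refl f).
Qed.

Let sups_neq0 f : [set sup (range h) | h in translate_average f] !=set0.
Proof. by exists (sup (range f)), f => //; exact: translate_average_refl. Qed.

(** Averaging [f + g] with the product weights [c i * d j] at [t i + s j] gives an average of [h]
    plus an average of [k], hence at most [sup h + sup k]. *)
Lemma uppermost_meanD f g : bounded_fun f -> bounded_fun g ->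
  uppermost_mean (f + g) <= uppermost_mean f + uppermost_mean g.
Proof.
move=> bf bg; apply: le_inf_add => // _ _ [h fh <-] [k gk <-].
have bh := translate_average_bounded _ _ bf fh.
have bk := translate_average_bounded _ _ bg gk.
move: fh gk => [n [c [t [_ c0 c1 hE]]]] [m [d [s [_ d0 d1 kE]]]].
pose w (i : 'I_n * 'I_m) := c i.1 * d i.2.
have w0 i : 0 <= w i by rewrite mulr_ge0.
have w1 : \sum_i w i = 1.
  rewrite -(pair_bigA _ (fun i j => c i * d j))/= -[RHS]c1.
  by apply: eq_bigr => i _; rewrite -mulr_sumr d1 mulr1.
have avg := translate_average_fin _ w (fun i => t i.1 + s i.2) (f + g) w0 w1.
apply: le_trans (uppermost_mean_le _ _ _ avg) _.
  exact: (linear_subsetD _ linear_subset_bounded_fun).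
apply: sup_range_le => x.
have -> : \sum_i w i * (f + g) (x + (t i.1 + s i.2)) =
    \sum_j d j * h (x + s j) + \sum_i c i * k (x + t i).
  under eq_bigr do rewrite [(f + g) _]/(f _ + g _) mulrDr.
  rewrite big_split/=; congr (_ + _).
    rewrite -(pair_bigA _ (fun i j => c i * d j * f (x + (t i + s j))))/=.
    rewrite exchange_big/=; apply: eq_bigr => j _; rewrite hE mulr_sumr.
    (* Commutativity of [G] enters here: the shift by [s j] must come before the one by [t i]. *)
    by apply: eq_bigr => i _; rewrite mulrCA mulrA (addrC (t i)) addrA.
  rewrite -(pair_bigA _ (fun i j => c i * d j * g (x + (t i + s j))))/=.
  apply: eq_bigr => i _; rewrite kE mulr_sumr.
  by apply: eq_bigr => j _; rewrite mulrA addrA.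
apply: lerD.
  rewrite -[leRHS]mul1r -d1 mulr_suml; apply: ler_sum => j _.
  by rewrite ler_wpM2l// le_sup_range.
rewrite -[leRHS]mul1r -c1 mulr_suml; apply: ler_sum => i _.
by rewrite ler_wpM2l// le_sup_range.
Qed.

Lemma sublinear_on_uppermost_mean :
  @sublinear_on R (G -> R) bounded_fun (@uppermost_mean R G).
Proof.
split; first exact: uppermost_meanD.
move=> c f bf c0; apply: le_mul_inf => // _ [h fh <-].
apply: le_trans (uppermost_mean_le _ _ _ (translate_averageZ c _ _ fh)) _.
  exact: (linear_subsetZ _ linear_subset_bounded_fun).
apply: sup_range_le => x; rewrite [leLHS]/(c * h x) ler_pM2l//.
exact: (le_sup_range _ _ (translate_average_bounded _ _ bf fh)).
Qed.

(** Negation matches averages of [f] with averages of [- f] and exchanges [sup] with [inf]. This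
    turns the lower bound on [alpha] into a bound by the uppermost mean of [- f]. *)
Lemma lowest_mean_geN f :
  bounded_fun f -> - uppermost_mean (- f) <= lowest_mean f.
Proof.
move=> bf; rewrite lerNl; apply: lb_le_inf => // _ [h fh <-].
have fNh : translate_average f (- h).
  by rewrite -[f]opprK; exact: translate_averageN.
have -> : sup (range h) = - inf (range (- h)).
  rewrite /inf opprK; congr sup; apply/seteqP; split.
    by move=> _ [x _ <-]; exists (- h x); rewrite ?opprK//; exists x.
  by move=> _ [_ [x _ <-] <-]; exists x => //; exact/esym/opprK.
rewrite lerN2; apply: ub_le_sup; last by exists (- h).
have /bounded_funP[B fB] := bf; exists B => _ [k fk <-].
have /bounded_funP[C kC] := translate_average_bounded _ _ bf fk.
apply: (@le_trans _ _ (k 0)).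
  apply: ge_inf; last by exists 0.
  exists (- C) => _ [x _ <-].
  by rewrite lerNl; apply: le_trans (kC x); rewrite -normrN ler_norm.
apply: (translate_average_le _ _ _ fk) => x.
exact: le_trans (ler_norm _) (fB x).
Qed.

(** The average over the shifts [0, t, ..., n t] telescopes and is at most [2 B / (n + 1)]; the
    Archimedean property concludes. *)
Lemma uppermost_mean_translateB f t : bounded_fun f ->
  uppermost_mean (fun x => f (x + t) - f x) <= 0.
Proof.
move=> bf; have [B fB] := (bounded_funP f).1 bf.
set g : G -> R := fun x => _; have bg : bounded_fun g.
  apply: (linear_subsetD _ linear_subset_bounded_fun _ (- f)).
    exact: bounded_fun_translate.
  exact: (linear_subsetN linear_subset_bounded_fun).
have le_n (n : nat) : uppermost_mean g <= n.+1%:R^-1 * (B + B).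
  have avg : translate_average g
      (fun x => \sum_(i < n.+1) n.+1%:R^-1 * g (x + t *+ i)).
    apply: (translate_average_fin 'I_n.+1 (fun=> n.+1%:R^-1)
      (fun i => t *+ i)) => [i|].
      by rewrite invr_ge0.
    by rewrite sumr_const card_ord -[_ *+ _]mulr_natr mulVf ?pnatr_eq0.
  apply: le_trans (uppermost_mean_le _ _ bg avg) _.
  apply: sup_range_le => x; rewrite -mulr_sumr ler_wpM2l ?invr_ge0//.
  rewrite -(big_mkord xpredT (fun i => g (x + t *+ i))).
  under eq_bigr do rewrite /g -addrA -mulrSr.
  rewrite telescope_sumr// mulr0n addr0; apply: lerD.
    exact: le_trans (ler_norm _) (fB _).
  by apply: le_trans (fB x); rewrite -normrN ler_norm.
rewrite leNgt; apply/negP => g0.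
have [n] : exists n : nat, (B + B) / uppermost_mean g < n.+1%:R.
  exists (Num.truncn ((B + B) / uppermost_mean g)); exact: truncnS_gt.
rewrite ltr_pdivrMr// => Bn; have := le_n n.
by rewrite mulrC ler_pdivlMr// leNgt mulrC Bn.
Qed.

(** Norming and monotonicity come from domination by suprema, restricted additivity from translation
    invariance together with oddness. *)
Lemma upper_mean_of_odd (U : (G -> R) -> R) :
  @sublinear_on R (G -> R) bounded_fun U ->
  (forall f, bounded_fun f -> U f <= uppermost_mean f) ->
  (forall f, bounded_fun f -> U (- f) = - U f) ->
  is_upper_mean U.
Proof.
move=> subU leU UN; have linB := linear_subset_bounded_fun.
have UD f g : bounded_fun f -> bounded_fun g -> U (f + g) <= U f + U g.
  exact: sublinear_onD.
have bN f : bounded_fun f -> bounded_fun (- f).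
  exact: (linear_subsetN linB).
have U_le f g : bounded_fun f -> bounded_fun g -> U (f - g) <= 0 -> U f <= U g.
  move=> bf bg Ufg.
  have := UD _ _ (linear_subsetD _ linB _ _ bf (bN _ bg)) bg; rewrite subrK.
  by move=> /le_trans; apply; rewrite gerDr.
have bcst (c : R) : bounded_fun ((fun=> c) : G -> R).
  by apply/bounded_funP; exists `|c|.
have cst_le (c : R) : U (fun=> c) <= c.
  by apply: le_trans (leU _ (bcst c)) _; exact: uppermost_mean_le_ub.
split.
- move=> c; apply/eqP; rewrite eq_le cst_le/=.
  by rewrite -lerN2 -UN//; exact: cst_le.
- move=> f g bf bg fg; apply: U_le => //.
  have bfg := linear_subsetD _ linB _ _ bf (bN _ bg).
  apply: le_trans (leU _ bfg) _; apply: uppermost_mean_le_ub => // x.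
  by rewrite [leLHS]/(f x - g x) subr_le0.
- by move=> c f bf c0; exact: (sublinear_onZ linB subU).
- move=> t f bf; have bft := bounded_fun_translate f t bf.
  have diff_le0 s h : bounded_fun h -> U (fun x => h (x + s)) <= U h.
    move=> bh; apply: U_le => //; first exact: bounded_fun_translate.
    apply: le_trans (leU _ _) _.
      apply: (linear_subsetD _ linB); last exact: bN.
      exact: bounded_fun_translate.
    exact: uppermost_mean_translateB.
  have UT : U (fun x => f (x + t)) = U f.
    apply/eqP; rewrite eq_le diff_le0//=.
    (* Shifting back by [- t] gives the reverse inequality. *)
    have := diff_le0 (- t) _ bft.
    by under [fun x => f (x - t + t)]eq_fun do rewrite subrK.
  rewrite -[fun x => _]/(f + (fun x => f (x + t))).
  rewrite mulr_natl mulr2n -{2}UT; apply/eqP; rewrite eq_le UD//=.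
  (* Superadditivity: split [f] as the sum minus its translate and use oddness. *)
  have := UD _ _ (linear_subsetD _ linB _ _ bf bft) (bN _ bft).
  by rewrite addrK UN// lerBrDr.
- exact: UD.
Qed.

End UppermostMean.

Theorem theorem8p4 (R : realType) (G : zmodType)
    (G_infinite : infinite_set [set: G]) (f : G -> R) (f_bounded : bounded_fun f)
    (alpha : R) (alpha_ge : lowest_mean f <= alpha)
    (alpha_le : alpha <= uppermost_mean f) :
  exists M : (G -> R) -> R, is_full_mean M /\ M f = alpha.
Proof.
have linB := @linear_subset_bounded_fun R G.
have alphaN_le : - alpha <= uppermost_mean (- f).
  by rewrite lerNl; exact: le_trans (lowest_mean_geN f f_bounded) alpha_ge.
have [U [subU leU UN Uf]] := hahn_banach_value linB
  sublinear_on_uppermost_mean f_bounded alpha_le alphaN_le.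
exists U; split => //; split => //.
- split; first exact: linear_subset0 linB.
  move=> a g h bg bh; apply: (linear_subsetD _ linB) => //.
  exact: (linear_subsetZ _ linB).
- exists U; split => //; first exact: upper_mean_of_odd.
  move=> g bg; split => // _.
  (* Oddness says exactly that [U] agrees with its conjugate, so the mean is full. *)
  by rewrite /conjugate_lower_mean -[fun x => _]/(- g) UN// opprK.
Qed.
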